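(* Let $(A,A')$ be a filtered opca and $U\subseteq A$ a downwards closed subset with $U\cap A'=\emptyset$. Then the tripos $[-,\mathcal{P}(\Pi)^U_{A,A'}]$ is equivalent (as a Set-indexed preorder) to the Booleanization of the tripos $[-,\mathcal{D}(A,A')]$ with respect to $U$.
   Context: Filtered opcas. Application associates to the left; $xy\leq z$ includes that $xy$ is defined. An opca is a poset $(A,\leq)$ with a partial binary application $a,b\mapsto ab$ such that: (i) if $ab$ is defined, $a'\leq a$ and $b'\leq b$, then $a'b'$ is defined and $a'b'\leq ab$; (ii) there are $\mathsf{k},\mathsf{s}\in A$ such that $\mathsf{k}xy\leq x$ for all $x,y$; $\mathsf{s}xy$ is defined for all $x,y$; and whenever $xz(yz)$ is defined, $\mathsf{s}xyz\leq xz(yz)$. A filtered opca $(A,A')$ is an opca $A$ with a subset $A'\subseteq A$ closed under (defined) application and containing choices for $\mathsf{k},\mathsf{s}$. For an application term $t$ in variables $x_1,\dots,x_n$ with constants from $A$, $\langle x_1\cdots x_n\rangle t$ denotes an element of $A$ (in $A'$ if the constants of $t$ are in $A'$) such that $(\langle x_1\cdots x_n\rangle t)a_1\cdots a_{n-1}$ is always defined and $(\langle x_1\cdots x_n\rangle t)a_1\cdots a_n\leq t[a_1,\dots,a_n]$ whenever the latter is defined. For a filtered opca $(A,A')$, the Set-indexed preorder $[-,A]$ (the filter is suppressed in the notation) assigns to a set $I$ the set of functions $I\to A$, with $\phi\leq\psi$ iff there is $a\in A'$ such that for all $i\in I$, $a\phi(i)$ is defined and $a\phi(i)\leq\psi(i)$;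 reindexing is composition. $\mathcal{D}(A,A')$ is the filtered opca of downwards closed subsets of $A$ ordered by inclusion, with $\alpha\beta$ defined iff $ab$ is defined for all $a\in\alpha,b\in\beta$, in which case it is the downwards closure of $\{ab\mid a\in\alpha,b\in\beta\}$, and filter $\{\alpha\mid\alpha\cap A'\neq\emptyset\}$. So in $[I,\mathcal{D}(A,A')]$, $\phi\leq\psi$ iff there is $a\in A'$ such that for all $i\in I$ and $b\in\phi(i)$, $ab$ is defined and in $\psi(i)$. Booleanization. For $\alpha\subseteq A$ let $\alpha\to U=\{a\in A\mid\text{for all }b\in\alpha,\ ab\text{ is defined and }ab\in U\}$; for $\phi:I\to\mathcal{D}A$ let $(\phi\to U)(i)=\phi(i)\to U$. The Booleanization of $[-,\mathcal{D}(A,A')]$ with respect to $U$ is the Boolean subtripos given, in any of the following equivalent ways, at a set $I$ by: (1) those $\phi:I\to\mathcal{D}A$ isomorphic to $(\phi\to U)\to U$ in $[I,\mathcal{D}(A,A')]$, as sub-preorder; (2) all $\phi:I\to\mathcal{D}A$, with $\phi\leq\psi$ iff $\phi\leq((\psi\to U)\to U)$ in $[I,\mathcal{D}(A,A')]$; (3) all $\phi:I\to\mathcal{D}A$, with $\phi\leq\psi$ iff $(\psi\to U)\leq(\phi\to U)$ in $[I,\mathcal{D}(A,A')]$. Sequence coding. Fix numerals $\bar{n}\in A'$ ($n\in\mathbb{N}$), a coding of finite sequences $(a_0,\dots,a_{n-1})$ of elements of $A$ by elements $[a_0,\dots,a_{n-1}]\in A$, and elements $\mathsf{b},\mathsf{c},\mathsf{d},\mathsf{t}\in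 A'$ such that: $\mathsf{b}\bar{n}[a_0,\dots,a_k]\leq a_n$ for $n\leq k$; $\mathsf{c}\bar{n}[a_0,\dots,a_k]\leq[a_n,\dots,a_k]$ for $n\leq k+1$ (the empty sequence if $n=k+1$); $\mathsf{d}a[a_0,\dots,a_{n-1}]\leq[a,a_0,\dots,a_{n-1}]$, and the left-hand side is itself a coded sequence; $\mathsf{t}a\leq[a]$. Such data exist. Write $\pi_i=\mathsf{b}\bar{i}\pi$ and $\pi_{\geq j}=\mathsf{c}\bar{j}\pi$. The abstract Krivine structure $\mathcal{K}^U_{A,A'}$: terms $\Lambda=A$; quasi-proofs $\mathsf{QP}=A'$; stacks $\Pi=$ the set of coded sequences; push operation $a.\pi=\mathsf{d}a\pi$ (associated to the right); $a\cdot b=\langle\pi\rangle a(b.\pi)$, precisely $a\cdot b=Mab$ with $M=\langle xy\pi\rangle x(\mathsf{d}y\pi)\in A'$; $k_\pi=\kappa\pi$ with $\kappa=\langle\pi\rho\rangle\rho_0\pi\in A'$; $\mathsf{K}=\langle\pi\rangle\pi_0\pi_{\geq2}$, $\mathsf{S}=\langle\pi\rangle((\pi_0\cdot\pi_2)\cdot(\pi_1\cdot\pi_2))\pi_{\geq3}$, $\mathsf{cc}=\langle\pi\rangle\pi_0(k_{\pi_{\geq1}}.\pi_{\geq1})$ (within these terms $x\cdot y$, $k_x$, $x.y$ stand for $Mxy$, $\kappa x$, $\mathsf{d}xy$); pole $\perp\!\!\!\perp\ =\{(t,\pi)\in A\times\Pi\mid t\pi\text{ is defined and }t\pi\in U\}$.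 Streicher's construction. For $V\subseteq\Lambda$ let $V^{\perp\!\!\!\perp}=\{\pi\in\Pi\mid\forall t\in V\,(t,\pi)\in\perp\!\!\!\perp\}$; for $\alpha\subseteq\Pi$ let $|\alpha|=\alpha^{\perp\!\!\!\perp}=\{t\in\Lambda\mid\forall\pi\in\alpha\,(t,\pi)\in\perp\!\!\!\perp\}$. $\mathcal{P}(\Pi)^U_{A,A'}$ denotes the filtered opca obtained from $\mathcal{K}^U_{A,A'}$: its underlying set is $\{\beta\subseteq\Pi\mid(\beta^{\perp\!\!\!\perp})^{\perp\!\!\!\perp}=\beta\}$ ordered by reverse inclusion; its (total) application is $\alpha\bullet\beta=(X^{\perp\!\!\!\perp})^{\perp\!\!\!\perp}$ where $X=\{\pi\in\Pi\mid\forall t\in|\alpha|\,\forall s\in|\beta|\ (t,s.\pi)\in\perp\!\!\!\perp\}$; its filter is $\{\alpha\mid|\alpha|\cap\mathsf{QP}\neq\emptyset\}$. *)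

(* Defs.v *)
From HB Require Import structures.
From mathcomp Require Import all_boot all_order.
From mathcomp Require Import boolp classical_sets.

Set Implicit Arguments.
Unset Strict Implicit.
Unset Printing Implicit Defensive.

Import Order.TTheory.
Local Open Scope order_scope.
Local Open Scope classical_set_scope.

Definition down_closed d (T : porderType d) (S : set T) : Prop :=
  forall a b : T, a <= b -> S b -> S a.

Section KleeneApplication.
Variables (d : Order.disp_t) (T : porderType d) (app : T -> T -> option T).

(* Partial elements are values of type [option T]; [None] is "undefined". *)
Definition strict_app (x y : option T) : option T :=
  obind (fun a => obind (app a) y) x.

(* If y is defined, then so is x, and x is below y.  When y is [Some a] this
   is the assertion "x is defined and x <= a". *)
Definition kle (x y : option T) : Prop :=
  forall b, y = Some b -> exists2 a, x = Some a & a <= b.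

Definition is_k (k : T) : Prop :=
  forall x y, kle (strict_app (strict_app (Some k) (Some x)) (Some y)) (Some x).

Definition is_s (s : T) : Prop :=
  (forall x y, isSome (strict_app (strict_app (Some s) (Some x)) (Some y))) /\
  (forall x y z,
    kle (strict_app (strict_app (strict_app (Some s) (Some x)) (Some y)) (Some z))
        (strict_app (strict_app (Some x) (Some z)) (strict_app (Some y) (Some z)))).

End KleeneApplication.

Arguments strict_app : simpl never.

Record opca := Opca {
  opca_disp : Order.disp_t;
  opca_sort :> porderType opca_disp;
  app : opca_sort -> opca_sort -> option opca_sort;
  app_mono : forall a a' b b' : opca_sort,
    a' <= a -> b' <= b -> kle (app a' b') (app a b);
  opca_ks : exists k s, is_k app k /\ is_s app s }.

Record filtered_opca := FilteredOpca {
  fopca_opca :> opca;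
  ffilter : set fopca_opca;
  ffilter_app : forall a b c : fopca_opca,
    ffilter a -> ffilter b -> app a b = Some c -> ffilter c;
  ffilter_k : exists2 k, ffilter k & is_k (@app fopca_opca) k;
  ffilter_s : exists2 s, ffilter s & is_s (@app fopca_opca) s }.

Arguments app {o} a b.
Arguments ffilter : clear implicits.

Declare Scope opca_scope.
Notation "x @@ y" := (strict_app app x y)
  (at level 40, left associativity) : opca_scope.
Notation "x <~ y" := (kle x y) (at level 70, no associativity) : opca_scope.
Local Open Scope opca_scope.

Lemma kle_refl (A : opca) (x : option A) : x <~ x.
Proof. by move=> b ->; exists b. Qed.

Lemma kle_trans (A : opca) (x y z : option A) : x <~ y -> y <~ z -> x <~ z.
Proof.
move=> xy yz c /yz [b /xy [a -> ab] bc]; exists a => //; exact: le_trans ab bc.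
Qed.

Lemma kle_app (A : opca) (x x' y y' : option A) :
  x' <~ x -> y' <~ y -> x' @@ y' <~ x @@ y.
Proof.
move=> xx yy c; case: x xx => [a|//] xx; case: y yy => [b|//] yy /= e.
have [a' -> aa] := xx _ erefl; have [b' -> bb] := yy _ erefl.
exact: app_mono aa bb _ e.
Qed.

Lemma kle_appl (A : opca) (x x' y : option A) : x' <~ x -> x' @@ y <~ x @@ y.
Proof. by move=> H; apply: kle_app H _; apply: kle_refl. Qed.

Lemma kle_appr (A : opca) (x y y' : option A) : y' <~ y -> x @@ y' <~ x @@ y.
Proof. by move=> H; apply: kle_app _ H; apply: kle_refl. Qed.

Lemma kle_SomeP (A : opca) (a b : A) : a <= b -> Some a <~ Some b.
Proof. by move=> ab _ [<-]; exists a. Qed.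

Lemma kle_some (A : opca) (x : option A) (a : A) : x <~ Some a -> isSome x.
Proof. by move=> /(_ _ erefl) [b ->]. Qed.

Lemma kapp_isSome (A : opca) (x y : option A) : isSome (x @@ y) -> isSome x.
Proof. by case: x. Qed.

Lemma ffilter_kapp (A : filtered_opca) (x y : option A) (c : A) :
  (forall a, x = Some a -> ffilter A a) ->
  (forall a, y = Some a -> ffilter A a) -> x @@ y = Some c -> ffilter A c.
Proof.
case: x => [a|//] /(_ _ erefl) Fa; case: y => [b|//] /(_ _ erefl) Fb /=.
exact: ffilter_app.
Qed.

Definition oextract (T : Type) (x : option T) : isSome x -> T :=
  match x with
  | Some a => fun=> a
  | None => fun h => False_rect T (notF h)
  end.

Lemma oextractK (T : Type) (x : option T) (h : isSome x) :
  Some (oextract h) = x.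
Proof. by case: x h. Qed.

(* Reindexing is pseudofunctorial: strict equality of fibre elements is not
   required, only isomorphism. *)
Record set_preorder := SetPreorder {
  fib : Type -> Type;
  fle : forall I, fib I -> fib I -> Prop;
  fle_refl : forall I (x : fib I), fle x x;
  fle_trans : forall I (x y z : fib I), fle x y -> fle y z -> fle x z;
  reindex : forall I J, (J -> I) -> fib I -> fib J;
  reindex_mono : forall I J (f : J -> I) (x y : fib I),
    fle x y -> fle (reindex f x) (reindex f y);
  reindex_id : forall I (x : fib I),
    fle (reindex id x) x /\ fle x (reindex id x);
  reindex_comp : forall I J K (f : J -> I) (g : K -> J) (x : fib I),
    fle (reindex (f \o g) x) (reindex g (reindex f x)) /\
    fle (reindex g (reindex f x)) (reindex (f \o g) x) }.

Arguments fib P I : rename.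
Arguments fle {P I} x y : rename.
Arguments reindex {P I J} f x : rename.

Definition fiso (P : set_preorder) I (x y : fib P I) : Prop :=
  fle x y /\ fle y x.

Record indexed_map (P Q : set_preorder) := IndexedMap {
  imap :> forall I, fib P I -> fib Q I;
  imap_mono : forall I (x y : fib P I), fle x y -> fle (imap x) (imap y);
  imap_natural : forall I J (f : J -> I) (x : fib P I),
    fiso (imap (reindex f x)) (reindex f (imap x)) }.

Definition indexed_equiv (P Q : set_preorder) : Prop :=
  exists (F : indexed_map P Q) (G : indexed_map Q P),
    (forall I (x : fib P I), fiso (G I (F I x)) x) /\
    (forall I (y : fib Q I), fiso (F I (G I y)) y).

Section Family.
Variable A : filtered_opca.

(* The fibre order of [-, A]. *)
Definition fam_le I (phi psi : I -> A) : Prop :=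
  exists2 a, ffilter A a & forall i, Some a @@ Some (phi i) <~ Some (psi i).

Lemma fam_le_refl I (phi : I -> A) : fam_le phi phi.
Proof.
have [k Fk Hk] := ffilter_k A; have [s Fs [Hs1 Hs2]] := ffilter_s A.
case e : (Some s @@ Some k @@ Some k) (Hs1 k k) => [i|//] _.
exists i => [|j].
  apply: (ffilter_kapp _ _ e) => [b h|b [<-] //].
  by apply: (ffilter_kapp _ _ h) => ? [<-].
rewrite -e; apply: kle_trans (Hs2 _ _ _) _.
have := kapp_isSome (kle_some (Hk (phi j) (phi j))).
by case: (Some k @@ Some (phi j)) (Hk (phi j)) => // kx Hkx _.
Qed.

Lemma fam_le_trans I (phi psi chi : I -> A) :
  fam_le phi psi -> fam_le psi chi -> fam_le phi chi.
Proof.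
have [k Fk Hk] := ffilter_k A; have [s Fs [Hs1 Hs2]] := ffilter_s A.
move=> [a Fa Ha] [b Fb Hb].
case ekb : (Some k @@ Some b) (kapp_isSome (kle_some (Hk b b))) => [kb|//] _.
case e : (Some s @@ Some kb @@ Some a) (Hs1 kb a) => [c|//] _.
have Fkb : ffilter A kb by apply: (ffilter_kapp _ _ ekb) => ? [<-].
exists c => [|j].
  apply: (ffilter_kapp _ _ e) => [d h|d [<-] //].
  by apply: (ffilter_kapp _ _ h) => ? [<-].
rewrite -e; apply: kle_trans (Hs2 _ _ _) _; rewrite -ekb.
apply: kle_trans (Hb j); apply: kle_app (Hk _ _) (Ha _).
Qed.

Definition fam : set_preorder := {|
  fib := fun I => I -> A;
  fle := fam_le;
  fle_refl := fam_le_refl;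
  fle_trans := fam_le_trans;
  reindex := fun I J f phi => phi \o f;
  reindex_mono := fun I J f phi psi '(ex_intro2 a Fa Ha) =>
    ex_intro2 _ _ a Fa (fun j => Ha (f j));
  reindex_id := fun I phi => conj (fam_le_refl phi) (fam_le_refl phi);
  reindex_comp := fun I J K f g phi =>
    conj (fam_le_refl (phi \o (f \o g))) (fam_le_refl (phi \o (f \o g))) |}.

End Family.

Record downset (A : opca) := Downset {
  dset :> set A;
  dsetP : down_closed dset }.

Lemma downset_eq (A : opca) (X Y : downset A) : dset X = dset Y -> X = Y.
Proof.
by case: X Y => [X HX] [Y HY] /= e; subst Y; congr Downset; exact: Prop_irrelevance.
Qed.

Section DownsetOrder.
Variable A : opca.

HB.instance Definition _ := gen_eqMixin (downset A).
HB.instance Definition _ := gen_choiceMixin (downset A).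

Definition downset_le (X Y : downset A) : bool := `[< dset X `<=` dset Y >].

Fact downset_le_refl : reflexive downset_le.
Proof. by move=> X; apply/asboolP. Qed.

Fact downset_le_anti : antisymmetric downset_le.
Proof.
move=> X Y /andP[/asboolP XY /asboolP YX]; apply: downset_eq.
by apply/seteqP; split.
Qed.

Fact downset_le_trans : transitive downset_le.
Proof.
move=> Y X Z /asboolP XY /asboolP YZ; apply/asboolP.
exact: subset_trans XY YZ.
Qed.

Fact downset_display : Order.disp_t.
Proof. exact: (Order.Disp tt tt). Qed.

HB.instance Definition _ :=
  Order.Le_isPOrder.Build downset_display (downset A)
    downset_le_refl downset_le_anti downset_le_trans.

End DownsetOrder.

Section DownsetOpca.
Variable A : filtered_opca.

Definition ds_prod (X Y : set A) : set A :=
  [set c | exists a b c', [/\ X a, Y b, app a b = Some c' & c <= c']].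

Fact ds_prod_down X Y : down_closed (ds_prod X Y).
Proof.
move=> c e ce [a [b [c' [Xa Yb abc' ec']]]]; exists a, b, c'; split=> //.
exact: le_trans ce ec'.
Qed.

Definition ds_app (X Y : downset A) : option (downset A) :=
  if `[< forall a b, dset X a -> dset Y b -> isSome (app a b) >]
  then Some (Downset (@ds_prod_down X Y)) else None.

Lemma ds_appP (X Y Z : downset A) : ds_app X Y = Some Z <->
  (forall a b, dset X a -> dset Y b -> isSome (app a b)) /\
  dset Z = ds_prod X Y.
Proof.
rewrite /ds_app; case: asboolP => H; split=> //.
- by case=> <-.
- by case=> _ e; congr Some; apply: downset_eq.
- by case.
Qed.

Lemma ds_leP (X Y : downset A) : X <= Y <-> dset X `<=` dset Y.
Proof. by split => [/asboolP|H]; [|apply/asboolP]. Qed.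

Fact ds_app_mono (a a' b b' : downset A) :
  a' <= a -> b' <= b -> kle (ds_app a' b') (ds_app a b).
Proof.
move=> /ds_leP aa /ds_leP bb c /ds_appP [H e].
exists (Downset (@ds_prod_down a' b')).
  by apply/ds_appP; split=> // x y /aa ? /bb ?; apply: H.
by apply/ds_leP => z /= [x [y [w [/aa ? /bb ? ? ?]]]]; rewrite e; exists x, y, w.
Qed.

Definition ds_principal (a : A) : downset A :=
  @Downset A [set c | c <= a] (fun c e ce ea => le_trans ce ea).

Lemma ds_k (k : A) : is_k app k -> is_k ds_app (ds_principal k).
Proof.
move=> Hk X Y _ [<-].
have Hk1 a x : a <= k -> isSome (app a x).
  move=> ak; have := kapp_isSome (kle_some (Hk x x)).
  case e : (Some k @@ Some x) => [kx|//] _.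
  by have [c /= -> _] := app_mono ak (lexx x) e.
pose KX := Downset (@ds_prod_down (ds_principal k) X).
have eKX : ds_app (ds_principal k) X = Some KX by apply/ds_appP; split=> // a b /Hk1.
have H c y : dset KX c -> exists2 x', dset X x' & Some c @@ Some y <~ Some x'.
  move=> [a [x' [c' [/= ak Xx' e cc']]]]; exists x' => //.
  apply: kle_trans (Hk x' y); apply: kle_appl.
  apply: kle_trans (kle_appl (kle_SomeP ak)).
  by rewrite /strict_app /= e; apply: kle_SomeP.
exists (Downset (@ds_prod_down KX Y)).
  rewrite /strict_app /= eKX /=; apply/ds_appP; split=> // c y KXc Yy.
  by have [x' _ /kle_some] := H _ y KXc.
apply/ds_leP => z /= [c [y [w [KXc Yy e zw]]]].
have [x' Xx' /(_ _ erefl) [v]] := H _ y KXc.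
rewrite /strict_app /= e => -[<-] wx; apply: dsetP Xx'; exact: le_trans zw wx.
Qed.

Lemma ds_s (s : A) : is_s app s -> is_s ds_app (ds_principal s).
Proof.
move=> [Hs1 Hs2].
have dapp (a : A) (X : downset A) a0 : a <= a0 ->
    (forall x, dset X x -> isSome (app a0 x)) ->
    forall x, dset X x -> isSome (app a x).
  move=> aa H x /H; case e : (app a0 x) => [c|//] _.
  by have [? ->] := app_mono aa (lexx x) e.
pose SX (X : downset A) := Downset (@ds_prod_down (ds_principal s) X).
pose SXY (X Y : downset A) := Downset (@ds_prod_down (SX X) Y).
have eS X : ds_app (ds_principal s) X = Some (SX X).
  apply/ds_appP; split=> // a x /= as' Xx; apply: (dapp _ X _ as') Xx => x' _.
  exact: kapp_isSome (Hs1 x' x').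
have inSX (X : downset A) c : dset (SX X) c -> exists2 x, dset X x & Some c <~ Some s @@ Some x.
  move=> [a [x [c' [/= as' Xx e cc']]]]; exists x => //.
  apply: kle_trans (kle_appl (kle_SomeP as')).
  by rewrite /strict_app /= e; apply: kle_SomeP.
have eSY (X Y : downset A) : ds_app (SX X) Y = Some (SXY X Y).
  apply/ds_appP; split=> // c y /inSX [x Xx H] Yy.
  have := kle_appl (y := Some y) H.
  case: (Some s @@ Some x @@ Some y) (Hs1 x y) => // ? _.
  exact: kle_some.
have inSXY (X Y : downset A) c : dset (SXY X Y) c -> exists x y,
    [/\ dset X x, dset Y y & Some c <~ Some s @@ Some x @@ Some y].
  move=> [a [y [c' [/inSX [x Xx H] Yy e cc']]]]; exists x, y; split=> //.
  apply: kle_trans (kle_appl H).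
  by rewrite /strict_app /= e; apply: kle_SomeP.
split=> [X Y|X Y Z W]; first by rewrite /strict_app /= eS /= eSY.
rewrite /strict_app /= eS /= eSY /=.
case eXZ : (ds_app X Z) => [XZ|//]; case eYZ : (ds_app Y Z) => [YZ|//] /= eW.
move: eXZ eYZ eW => /ds_appP [dXZ eXZ] /ds_appP [dYZ eYZ] /ds_appP [dW eW].
have H c z : dset (SXY X Y) c -> dset Z z ->
    exists2 w, dset W w & Some c @@ Some z <~ Some w.
  move=> /inSXY [x [y [Xx Yy Hc]]] Zz.
  case exz : (app x z) (dXZ _ _ Xx Zz) => [xz|//] _.
  case eyz : (app y z) (dYZ _ _ Yy Zz) => [yz|//] _.
  have XZxz : dset XZ xz by rewrite eXZ; exists x, z, xz.
  have YZyz : dset YZ yz by rewrite eYZ; exists y, z, yz.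
  case e : (app xz yz) (dW _ _ XZxz YZyz) => [w|//] _.
  exists w; first by rewrite eW; exists xz, yz, w.
  apply: kle_trans (kle_appl Hc) _.
  apply: kle_trans (Hs2 _ _ _) _.
  by rewrite /strict_app /= exz eyz /= e; apply: kle_refl.
exists (Downset (@ds_prod_down (SXY X Y) Z)).
  apply/ds_appP; split=> // c z Sc Zz.
  by have [w _ /kle_some] := H _ _ Sc Zz.
apply/ds_leP => v /= [c [z [u [Sc Zz e vu]]]].
have [w Ww /(_ _ erefl) [u']] := H _ _ Sc Zz.
rewrite /strict_app /= e => -[<-] uw; apply: dsetP Ww; exact: le_trans vu uw.
Qed.

Fact ds_ks : exists k s, is_k ds_app k /\ is_s ds_app s.
Proof.
have [k _ Hk] := ffilter_k A; have [s _ Hs] := ffilter_s A.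
by exists (ds_principal k), (ds_principal s); split; [exact: ds_k|exact: ds_s].
Qed.

Definition down_opca : opca := Opca ds_app_mono ds_ks.

Definition down_filter : set down_opca :=
  [set X : downset A | dset X `&` ffilter A !=set0].

Fact down_filter_app (X Y Z : down_opca) :
  down_filter X -> down_filter Y -> app X Y = Some Z -> down_filter Z.
Proof.
move=> [a [Xa Fa]] [b [Yb Fb]] /ds_appP [H e].
case eab : (app a b) (H _ _ Xa Yb) => [c|//] _; exists c; split.
  by rewrite e; exists a, b, c.
exact: ffilter_app eab.
Qed.

Fact down_filter_k : exists2 k, down_filter k & is_k (@app down_opca) k.
Proof.
have [k Fk Hk] := ffilter_k A; exists (ds_principal k); last exact: ds_k.
by exists k; split => //=.
Qed.

Fact down_filter_s : exists2 s, down_filter s & is_s (@app down_opca) s.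
Proof.
have [s Fs Hs] := ffilter_s A; exists (ds_principal s); last exact: ds_s.
by exists s; split => //=.
Qed.

Definition down_fopca : filtered_opca :=
  FilteredOpca down_filter_app down_filter_k down_filter_s.

End DownsetOpca.

Section Booleanization.
Variables (A : filtered_opca) (U : downset A).

Definition in_U (x : option A) : Prop := exists2 u, x = Some u & dset U u.

Lemma in_U_kle (x y : option A) : x <~ y -> in_U y -> in_U x.
Proof.
move=> xy [u /xy [v -> vu] Uu]; exists v => //; exact: dsetP Uu.
Qed.

Definition to_U_set (X : set A) : set A :=
  [set a | forall b, X b -> in_U (app a b)].

Fact to_U_down X : down_closed (to_U_set X).
Proof.
move=> a a' aa Ha b /Ha; apply: in_U_kle; exact: app_mono.
Qed.

Definition to_U (X : downset A) : downset A := Downset (@to_U_down (dset X)).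

Definition neg_U I (phi : I -> down_fopca A) : I -> down_fopca A :=
  fun i => to_U (phi i).

(* [dn_le], [contra_le] and, below, [stable_fib] give the three presentations
   of the Booleanization: phi <= ((psi -> U) -> U), (psi -> U) <= (phi -> U),
   and the full sub-preorder on the phi isomorphic to (phi -> U) -> U. *)
Definition dn_le I (phi psi : I -> down_fopca A) : Prop :=
  fam_le phi (neg_U (neg_U psi)).

Definition contra_le I (phi psi : I -> down_fopca A) : Prop :=
  fam_le (neg_U psi) (neg_U phi).

Lemma down_fam_leP I (phi psi : I -> down_fopca A) : fam_le phi psi <->
  exists2 a, ffilter A a & forall i b, dset (phi i) b ->
    exists2 c, app a b = Some c & dset (psi i) c.
Proof.
split=> [[X [a [Xa Fa]] HX]|[a Fa Ha]].
  exists a => // i b phib; have [Z /ds_appP [H e]] := HX i _ erefl.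
  move=> /ds_leP Zpsi; case eab : (app a b) (H _ _ Xa phib) => [c|//] _.
  by exists c => //; apply: Zpsi; rewrite e; exists a, b, c.
exists (ds_principal a : down_fopca A); first by exists a; split => //=.
have app_le c b d : c <= a -> app a b = Some d ->
    exists2 d', app c b = Some d' & d' <= d.
  by move=> ca; apply: app_mono.
move=> i _ [<-]; exists (Downset (@ds_prod_down _ (ds_principal a) (phi i))).
  apply/ds_appP; split=> // c b /= ca /Ha [d /(app_le _ _ _ ca) [d' -> _]] //.
apply/ds_leP => z /= [c [b [w [ca /Ha [d eab psid] ecb zw]]]].
have [d' e' dd] := app_le _ _ _ ca eab; apply: dsetP psid.
by move: e'; rewrite ecb => -[ew]; rewrite -ew in dd; apply: le_trans zw dd.
Qed.

Lemma neg_flip I (phi theta : I -> down_fopca A) :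
  fam_le phi (neg_U theta) -> fam_le theta (neg_U phi).
Proof.
have [k Fk Hk] := ffilter_k A; have [s Fs [Hs1 Hs2]] := ffilter_s A.
move=> /down_fam_leP [a Fa Ha]; apply/down_fam_leP.
case esa : (Some s @@ Some a) (kapp_isSome (Hs1 a a)) => [sa|//] _.
case eks : (Some k @@ Some sa) (kapp_isSome (kle_some (Hk sa sa))) => [ks|//] _.
case e : (Some s @@ Some ks @@ Some k) (Hs1 ks k) => [f|//] _.
have Fsa : ffilter A sa by apply: (ffilter_kapp _ _ esa) => ? [<-].
have Fks : ffilter A ks by apply: (ffilter_kapp _ _ eks) => ? [<-].
exists f.
  apply: (ffilter_kapp _ _ e) => [g h|g [<-] //].
  by apply: (ffilter_kapp _ _ h) => ? [<-].
have fx x : exists2 kx, Some k @@ Some x = Some kx &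
    Some f @@ Some x <~ Some sa @@ Some kx.
  case ekx : (Some k @@ Some x) (kapp_isSome (kle_some (Hk x x))) => [kx|//] _.
  exists kx => //; rewrite -e; apply: kle_trans (Hs2 _ _ _) _; rewrite ekx -eks.
  exact: kle_appl (Hk _ _).
move=> i x thx; have [kx ekx H] := fx x.
case efx : (Some f @@ Some x) => [c|]; last first.
  move: H; rewrite efx -esa.
  by case: (Some s @@ Some a @@ Some kx) (Hs1 a kx) => // d _ /kle_some.
exists c => // y phiy; have [d eay Hd] := Ha _ _ phiy.
apply: in_U_kle (Hd x thx).
change (Some c @@ Some y <~ Some d @@ Some x); rewrite -efx.
apply: kle_trans (kle_appl H) _; rewrite -esa.
apply: kle_trans (Hs2 _ _ _) _; rewrite -ekx.
have -> : Some d = Some a @@ Some y by [].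
exact: kle_appr (Hk _ _).
Qed.

Lemma dn_contra_le I (phi psi : I -> down_fopca A) :
  dn_le phi psi <-> contra_le phi psi.
Proof. by split; apply: neg_flip. Qed.

Lemma dn_le_refl I (phi : I -> down_fopca A) : dn_le phi phi.
Proof. by apply/dn_contra_le; apply: fam_le_refl. Qed.

Lemma dn_le_trans I (phi psi chi : I -> down_fopca A) :
  dn_le phi psi -> dn_le psi chi -> dn_le phi chi.
Proof.
move=> /dn_contra_le H1 /dn_contra_le H2; apply/dn_contra_le.
exact: fam_le_trans H2 H1.
Qed.

Lemma fam_le_reindex (B : filtered_opca) I J (f : J -> I) (phi psi : I -> B) :
  fam_le phi psi -> fam_le (phi \o f) (psi \o f).
Proof. by move=> [a Fa Ha]; exists a => // j; apply: Ha. Qed.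

Definition stable_fib I : Type :=
  {phi : I -> down_fopca A |
    fiso (P := fam (down_fopca A)) phi (neg_U (neg_U phi))}.

Definition stable_reindex I J (f : J -> I) (phi : stable_fib I) : stable_fib J :=
  exist _ (sval phi \o f)
    (conj (fam_le_reindex f (proj1 (svalP phi)))
          (fam_le_reindex f (proj2 (svalP phi)))).

Definition booleanization_stable : set_preorder := {|
  fib := stable_fib;
  fle := fun I phi psi => fam_le (sval phi) (sval psi);
  fle_refl := fun I phi => fam_le_refl (sval phi);
  fle_trans := fun I phi psi chi => @fam_le_trans _ I _ _ _;
  reindex := stable_reindex;
  reindex_mono := fun I J f phi psi => @fam_le_reindex _ I J f _ _;
  reindex_id := fun I phi =>
    conj (fam_le_refl (sval phi)) (fam_le_refl (sval phi));
  reindex_comp := fun I J K f g phi =>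
    conj (fam_le_refl (sval phi \o (f \o g)))
         (fam_le_refl (sval phi \o (f \o g))) |}.

Definition booleanization_dn : set_preorder := {|
  fib := fun I => I -> down_fopca A;
  fle := dn_le;
  fle_refl := dn_le_refl;
  fle_trans := dn_le_trans;
  reindex := fun I J f phi => phi \o f;
  reindex_mono := fun I J f phi psi => @fam_le_reindex _ I J f _ _;
  reindex_id := fun I phi => conj (dn_le_refl phi) (dn_le_refl phi);
  reindex_comp := fun I J K f g phi =>
    conj (dn_le_refl (phi \o (f \o g))) (dn_le_refl (phi \o (f \o g))) |}.

Definition booleanization_contra : set_preorder := {|
  fib := fun I => I -> down_fopca A;
  fle := contra_le;
  fle_refl := fun I phi => fam_le_refl (neg_U phi);
  fle_trans := fun I phi psi chi H1 H2 => fam_le_trans H2 H1;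
  reindex := fun I J f phi => phi \o f;
  reindex_mono := fun I J f phi psi => @fam_le_reindex _ I J f _ _;
  reindex_id := fun I phi =>
    conj (fam_le_refl (neg_U phi)) (fam_le_refl (neg_U phi));
  reindex_comp := fun I J K f g phi =>
    conj (fam_le_refl (neg_U (phi \o (f \o g))))
         (fam_le_refl (neg_U (phi \o (f \o g)))) |}.

End Booleanization.

(* Streicher's abstract Krivine structures; the last five fields are his
   axioms, with [apole t p] for membership of (t, p) in the pole. *)
Record aks := Aks {
  aterm : Type;
  astack : Type;
  aqp : set aterm;
  apole : aterm -> astack -> Prop;
  atapp : aterm -> aterm -> aterm;
  apush : aterm -> astack -> astack;
  akont : astack -> aterm;
  aK : aterm;
  aS : aterm;
  acc : aterm;
  aqp_app : forall t s, aqp t -> aqp s -> aqp (atapp t s);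
  aqp_K : aqp aK;
  aqp_S : aqp aS;
  aqp_cc : aqp acc;
  apole_app : forall t s p, apole t (apush s p) -> apole (atapp t s) p;
  apole_K : forall t s p, apole t p -> apole aK (apush t (apush s p));
  apole_S : forall t s u p, apole (atapp (atapp t u) (atapp s u)) p ->
    apole aS (apush t (apush s (apush u p)));
  apole_cc : forall t p, apole t (apush (akont p) p) -> apole acc (apush t p);
  apole_kont : forall t p q, apole t p -> apole (akont p) (apush t q) }.

Section Streicher.
Variable K : aks.
Implicit Types (V W : set (aterm K)) (X Y : set (astack K)).

Definition orth V : set (astack K) := [set p | forall t, V t -> apole t p].

Definition reals X : set (aterm K) := [set t | forall p, X p -> apole t p].

Definition biorth X : set (astack K) := orth (reals X).

Lemma sub_biorth X : X `<=` biorth X.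
Proof. by move=> p Xp t; apply. Qed.

Lemma orthS V W : V `<=` W -> orth W `<=` orth V.
Proof. by move=> VW p Hp t /VW; apply: Hp. Qed.

Lemma realsS X Y : X `<=` Y -> reals Y `<=` reals X.
Proof. by move=> XY t Ht p /XY; apply: Ht. Qed.

Lemma biorth_orth V : biorth (orth V) = orth V.
Proof.
apply/seteqP; split; last exact: sub_biorth.
by apply: orthS => t Vt p; apply.
Qed.

Record bistable := Bistable {
  bset :> set (astack K);
  bsetP : biorth bset = bset }.

Lemma bistable_eq (X Y : bistable) : bset X = bset Y -> X = Y.
Proof.
by case: X Y => [X HX] [Y HY] /= e; subst Y; congr Bistable; exact: Prop_irrelevance.
Qed.

HB.instance Definition _ := gen_eqMixin bistable.
HB.instance Definition _ := gen_choiceMixin bistable.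

Definition bistable_le (X Y : bistable) : bool := `[< bset Y `<=` bset X >].

Fact bistable_le_refl : reflexive bistable_le.
Proof. by move=> X; apply/asboolP. Qed.

Fact bistable_le_anti : antisymmetric bistable_le.
Proof.
move=> X Y /andP[/asboolP XY /asboolP YX]; apply: bistable_eq.
by apply/seteqP; split.
Qed.

Fact bistable_le_trans : transitive bistable_le.
Proof.
move=> Y X Z /asboolP YX /asboolP ZY; apply/asboolP.
exact: subset_trans ZY YX.
Qed.

Fact bistable_display : Order.disp_t.
Proof. exact: (Order.Disp tt tt). Qed.

HB.instance Definition _ :=
  Order.Le_isPOrder.Build bistable_display bistable
    bistable_le_refl bistable_le_anti bistable_le_trans.

Lemma bs_leP (X Y : bistable) : X <= Y <-> bset Y `<=` bset X.
Proof. by split => [/asboolP|H]; [|apply/asboolP]. Qed.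

Definition bs_orth V : bistable := Bistable (biorth_orth V).

Definition push_set X Y : set (astack K) :=
  [set p | forall t s, reals X t -> reals Y s -> apole t (apush s p)].

Definition bs_bullet (X Y : bistable) : bistable :=
  bs_orth (reals (push_set (bset X) (bset Y))).

Definition bs_app (X Y : bistable) : option bistable := Some (bs_bullet X Y).

Lemma push_setS X X' Y Y' :
  X `<=` X' -> Y `<=` Y' -> push_set X Y `<=` push_set X' Y'.
Proof.
by move=> XX YY p H t s /(realsS XX) Xt /(realsS YY) Ys; apply: H.
Qed.

Fact bs_app_mono (X X' Y Y' : bistable) :
  X' <= X -> Y' <= Y -> kle (bs_app X' Y') (bs_app X Y).
Proof.
move=> /bs_leP XX /bs_leP YY _ [<-]; exists (bs_bullet X' Y') => //.
by apply/bs_leP; apply: orthS; apply: realsS; apply: push_setS.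
Qed.

Lemma reals_bullet (X Y : bistable) t s :
  reals (bset X) t -> reals (bset Y) s -> reals (bset (bs_bullet X Y)) (atapp t s).
Proof.
move=> Xt Ys p; apply => q Hq; apply: apole_app; exact: Hq.
Qed.

Lemma bs_k : is_k bs_app (bs_orth [set aK K]).
Proof.
move=> X Y _ [<-]; rewrite /strict_app /=; eexists; first reflexivity.
apply/bs_leP => p Xp; apply: sub_biorth => t s Ht Ys; apply: Ht.
apply: sub_biorth => t' u Ht' Xu; apply: Ht' => _ ->.
by apply: apole_K; apply: Xu.
Qed.

Lemma bs_s : is_s bs_app (bs_orth [set aS K]).
Proof.
split=> // X Y Z _ [<-]; rewrite /strict_app /=; eexists; first reflexivity.
apply/bs_leP; rewrite -[X in _ `<=` X]bsetP; apply: orthS; apply: realsS.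
move=> p Hp; apply: sub_biorth => t u Ht Zu; apply: Ht; apply: sub_biorth.
move=> t' b Ht' Yb; apply: Ht'; apply: sub_biorth => t'' a Ht'' Xa.
apply: Ht'' => _ ->.
by apply: apole_S; apply: apole_app; apply: Hp; apply: reals_bullet.
Qed.

Fact bs_ks : exists k s, is_k bs_app k /\ is_s bs_app s.
Proof.
exists (bs_orth [set aK K]), (bs_orth [set aS K]).
by split; [exact: bs_k|exact: bs_s].
Qed.

Definition streicher_opca : opca := Opca bs_app_mono bs_ks.

Definition bs_filter : set streicher_opca :=
  [set X : bistable | reals (bset X) `&` aqp (a := K) !=set0].

Fact bs_filter_app (X Y Z : streicher_opca) :
  bs_filter X -> bs_filter Y -> app X Y = Some Z -> bs_filter Z.
Proof.
move=> [t [Xt Qt]] [s [Ys Qs]] [<-]; exists (atapp t s); split.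
  exact: reals_bullet.
exact: aqp_app.
Qed.

Fact bs_filter_k : exists2 k, bs_filter k & is_k (@app streicher_opca) k.
Proof.
exists (bs_orth [set aK K]); last exact: bs_k.
by exists (aK K); split; [move=> p; apply|exact: aqp_K].
Qed.

Fact bs_filter_s : exists2 s, bs_filter s & is_s (@app streicher_opca) s.
Proof.
exists (bs_orth [set aS K]); last exact: bs_s.
by exists (aS K); split; [move=> p; apply|exact: aqp_S].
Qed.

Definition streicher_fopca : filtered_opca :=
  FilteredOpca bs_filter_app bs_filter_k bs_filter_s.

End Streicher.

(* The laws for [seq_b] and [seq_c] concern nonempty sequences only; [onth l n]
   is [None] when n is out of range, and then [seq_bE] asserts nothing.  In
   [seq_dE] the product is itself a code, possibly of another sequence. *)
Record seq_coding (A : filtered_opca) := SeqCoding {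
  num : nat -> A;
  code : seq A -> A;
  seq_b : A;
  seq_c : A;
  seq_d : A;
  seq_t : A;
  num_filter : forall n, ffilter A (num n);
  seq_b_filter : ffilter A seq_b;
  seq_c_filter : ffilter A seq_c;
  seq_d_filter : ffilter A seq_d;
  seq_t_filter : ffilter A seq_t;
  seq_bE : forall n l, Some seq_b @@ Some (num n) @@ Some (code l) <~ onth l n;
  seq_cE : forall n a l, (n <= size (a :: l))%N ->
    Some seq_c @@ Some (num n) @@ Some (code (a :: l)) <~
    Some (code (drop n (a :: l)));
  seq_dE : forall a l, exists2 l',
    Some seq_d @@ Some a @@ Some (code l) = Some (code l') &
    code l' <= code (a :: l);
  seq_tE : forall a, Some seq_t @@ Some a <~ Some (code [:: a]) }.

Arguments seq_bE {A} s n l : rename.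
Arguments seq_cE {A} s {n a l} h : rename.
Arguments seq_tE {A} s a : rename.

Section KrivineTerms.
Variables (A : filtered_opca) (C : seq_coding A).
Implicit Types (p x y : option A).

Definition item n p := Some (seq_b C) @@ Some (num C n) @@ p.
Definition tail n p := Some (seq_c C) @@ Some (num C n) @@ p.
Definition cons_term x y := Some (seq_d C) @@ x @@ y.

(* [lamN e t] says that e is a possible value of <x_1 ... x_N>t. *)
Definition lam1 (e : A) (t : option A -> option A) : Prop :=
  forall a, Some e @@ Some a <~ t (Some a).

Definition lam2 (e : A) (t : option A -> option A -> option A) : Prop :=
  (forall a, isSome (Some e @@ Some a)) /\
  (forall a b, Some e @@ Some a @@ Some b <~ t (Some a) (Some b)).

Definition lam3 (e : A) (t : option A -> option A -> option A -> option A) :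
    Prop :=
  (forall a b, isSome (Some e @@ Some a @@ Some b)) /\
  (forall a b c,
    Some e @@ Some a @@ Some b @@ Some c <~ t (Some a) (Some b) (Some c)).

(* <x_1 ... x_N>t is only specified by its application behaviour, so the
   combinators are arbitrary elements of the filter meeting that
   specification. *)
Record krivine_terms := KrivineTerms {
  kM : A;
  kkappa : A;
  kK : A;
  kS : A;
  kcc : A;
  kM_filter : ffilter A kM;
  kkappa_filter : ffilter A kkappa;
  kK_filter : ffilter A kK;
  kS_filter : ffilter A kS;
  kcc_filter : ffilter A kcc;
  kME : lam3 kM (fun x y p => x @@ cons_term y p);
  kkappaE : lam2 kkappa (fun p r => item 0 r @@ p);
  kKE : lam1 kK (fun p => item 0 p @@ tail 2 p);
  kSE : lam1 kS (fun p =>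
    let dot x y := Some kM @@ x @@ y in
    dot (dot (item 0 p) (item 2 p)) (dot (item 1 p) (item 2 p)) @@ tail 3 p);
  kccE : lam1 kcc (fun p =>
    item 0 p @@ cons_term (Some kkappa @@ tail 1 p) (tail 1 p)) }.

End KrivineTerms.

Arguments kKE {A C} k a : rename.
Arguments kSE {A C} k a : rename.
Arguments kccE {A C} k a : rename.

Section KrivineStructure.
Variables (A : filtered_opca) (C : seq_coding A) (T : krivine_terms C).
Variable (U : downset A).

Definition kstack : Type := {p : A | exists l, p = code C l}.

Definition kpole (t : A) (p : kstack) : Prop := in_U U (app t (sval p)).

Definition ktapp (t s : A) : A := oextract (proj1 (kME T) t s).

Fact kpush_isSome (t : A) (p : kstack) :
  isSome (cons_term C (Some t) (Some (sval p))).
Proof.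
have [l e] := svalP p; have [l' e' _] := seq_dE C t l.
by rewrite /cons_term e e'.
Qed.

Fact kpush_coded (t : A) (p : kstack) :
  exists l, oextract (kpush_isSome t p) = code C l.
Proof.
have [l e] := svalP p; have [l' el' _] := seq_dE C t l; exists l'.
by apply: Some_inj; rewrite oextractK /cons_term e.
Qed.

Definition kpush (t : A) (p : kstack) : kstack :=
  exist _ (oextract (kpush_isSome t p)) (kpush_coded t p).

Fact kkont_isSome (p : kstack) : isSome (Some (kkappa T) @@ Some (sval p)).
Proof. exact: (proj1 (kkappaE T)). Qed.

Definition kkont (p : kstack) : A := oextract (kkont_isSome p).

Lemma kpushE t p : Some (sval (kpush t p)) = cons_term C (Some t) (Some (sval p)).
Proof. exact: oextractK. Qed.

Lemma ktappE t s : Some (ktapp t s) = Some (kM T) @@ Some t @@ Some s.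
Proof. exact: oextractK. Qed.

Lemma kkontE p : Some (kkont p) = Some (kkappa T) @@ Some (sval p).
Proof. exact: oextractK. Qed.

Lemma kpoleE t p : kpole t p = in_U U (Some t @@ Some (sval p)).
Proof. by []. Qed.

Lemma kpush_le (t : A) (p : kstack) l : sval p <= code C l ->
  sval (kpush t p) <= code C (t :: l).
Proof.
move=> pl; have [l' el' le'] := seq_dE C t l.
have := kle_appr (x := Some (seq_d C) @@ Some t) (kle_SomeP pl).
move=> /(_ _ el') [a e al'].
have -> : sval (kpush t p) = a by apply: Some_inj; rewrite kpushE.
exact: le_trans al' le'.
Qed.

Lemma item_le n (p : kstack) l : sval p <= code C l ->
  item C n (Some (sval p)) <~ onth l n.
Proof.
move=> pl; apply: kle_trans (seq_bE C n l).
exact: kle_appr (kle_SomeP pl).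
Qed.

Lemma tail_le n (p : kstack) a l : sval p <= code C (a :: l) ->
  (n <= size (a :: l))%N ->
  tail C n (Some (sval p)) <~ Some (code C (drop n (a :: l))).
Proof.
move=> pl nl; apply: kle_trans (seq_cE C nl).
exact: kle_appr (kle_SomeP pl).
Qed.

Fact kqp_app t s : ffilter A t -> ffilter A s -> ffilter A (ktapp t s).
Proof.
move=> Ft Fs; apply: (ffilter_kapp _ _ (esym (ktappE t s))) => [x h|x [<-] //].
by apply: (ffilter_kapp _ _ h) => ? [<-] //; apply: kM_filter.
Qed.

Fact kpole_app t s p : kpole t (kpush s p) -> kpole (ktapp t s) p.
Proof.
rewrite !kpoleE; apply: in_U_kle; rewrite ktappE kpushE.
exact: (proj2 (kME T)).
Qed.

Fact kpole_K t s p : kpole t p -> kpole (kK T) (kpush t (kpush s p)).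
Proof.
rewrite !kpoleE; have [l el] := svalP p.
have le1 : sval (kpush t (kpush s p)) <= code C [:: t, s & l].
  by do 2!apply: kpush_le; rewrite el.
apply: in_U_kle; apply: kle_trans (kKE T _) _.
apply: kle_app; first exact: item_le le1.
by have := tail_le (n := 2) le1 isT; rewrite /= drop0 -el.
Qed.

Fact kpole_S t s u p : kpole (ktapp (ktapp t u) (ktapp s u)) p ->
  kpole (kS T) (kpush t (kpush s (kpush u p))).
Proof.
rewrite !kpoleE; have [l el] := svalP p.
have le1 : sval (kpush t (kpush s (kpush u p))) <= code C [:: t, s, u & l].
  by do 3!apply: kpush_le; rewrite el.
apply: in_U_kle; apply: kle_trans (kSE T _) _; rewrite !ktappE.
apply: kle_app; last by have := tail_le (n := 3) le1 isT; rewrite /= drop0 -el.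
by do !apply: kle_app; first [exact: kle_refl | exact: item_le le1].
Qed.

Fact kpole_cc t p : kpole t (kpush (kkont p) p) -> kpole (kcc T) (kpush t p).
Proof.
rewrite !kpoleE; have [l el] := svalP p.
have le1 : sval (kpush t p) <= code C (t :: l) by apply: kpush_le; rewrite el.
apply: in_U_kle; apply: kle_trans (kccE T _) _.
rewrite (kpushE (kkont p)) kkontE.
have H1 : tail C 1 (Some (sval (kpush t p))) <~ Some (sval p).
  by have := tail_le (n := 1) le1 isT; rewrite /= drop0 -el.
apply: kle_app; first exact: item_le le1.
by do !apply: kle_app; first [exact: H1 | exact: kle_refl].
Qed.

Fact kpole_kont t p q : kpole t p -> kpole (kkont p) (kpush t q).
Proof.
rewrite !kpoleE; have [l el] := svalP q.
have le1 : sval (kpush t q) <= code C (t :: l) by apply: kpush_le; rewrite el.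
apply: in_U_kle; rewrite kkontE; apply: kle_trans (proj2 (kkappaE T) _ _) _.
by apply: kle_app; [exact: item_le le1|exact: kle_refl].
Qed.

Definition krivine_aks : aks := {|
  aterm := A;
  astack := kstack;
  aqp := ffilter A;
  apole := kpole;
  atapp := ktapp;
  apush := kpush;
  akont := kkont;
  aK := kK T;
  aS := kS T;
  acc := kcc T;
  aqp_app := kqp_app;
  aqp_K := kK_filter T;
  aqp_S := kS_filter T;
  aqp_cc := kcc_filter T;
  apole_app := kpole_app;
  apole_K := kpole_K;
  apole_S := kpole_S;
  apole_cc := kpole_cc;
  apole_kont := kpole_kont |}.

End KrivineStructure.

(* Main.v *)
Require Import Defs.
From mathcomp Require Import all_boot all_order.
From mathcomp Require Import boolp classical_sets.

(** The equivalence sends a family [phi] of biorthogonally closed sets of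
    stacks to the family of its sets of realizers, written |phi| below.  An
    element [t] realizes a set [X] of stacks exactly when it sends every stack
    in [X] into [U]; so |X| is X -> U, with [X] replaced by its downward
    closure, and families of realizers, being negations, are stable under
    double negation into [U].

    This is an order embedding into [-, D(A, A')] ([fam_le_realizers]).  If a
    quasi-proof [t] realizes [phi <= psi], then s |-> t . s, which is
    application to M t in [A], takes realizers of [phi] to realizers of [psi].
    Conversely, if [a] takes realizers of [phi] to realizers of [psi], then
    <rho> a rho_0 rho_(>=1) takes the stack s.pi, for [s] in |phi| and [pi] in
    [psi], to an element below a s pi, hence into [U].

    It is essentially surjective up to double negation: to a family [alpha] of
    downsets corresponds the biorthogonal closure of the set of one-element
    sequences (u) with [u] in alpha -> U.  Its realizers are the [t] that send
    each of these codes into [U], and they are interchangeable with the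
    elements of (alpha -> U) -> U, because [u] and the code of (u) can be
    computed from each other up to the order ([realizers_of_down_fam]).

    A natural and fibrewise essentially surjective order embedding is an
    equivalence ([indexed_equiv_of_embedding]).  This applies to each of the
    three presentations of the Booleanization: their orders agree on stable
    families, and in the last two every family is isomorphic to its double
    negation. *)

Set Implicit Arguments.
Unset Strict Implicit.
Unset Printing Implicit Defensive.

Import Order.TTheory.
Local Open Scope order_scope.
Local Open Scope classical_set_scope.
Local Open Scope opca_scope.

(** * Equivalences of indexed preorders *)

(** Preimages chosen pointwise are automatically monotone and natural, because
    [F] reflects the order: it suffices to compare their images. *)
Lemma indexed_equiv_of_embedding (P Q : set_preorder)
    (F : forall I, fib P I -> fib Q I) (G : forall I, fib Q I -> fib P I) :
  (forall I (x y : fib P I), fle (F I x) (F I y) <-> fle x y) ->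
  (forall I J (f : J -> I) (x : fib P I),
    fiso (F J (Defs.reindex f x)) (Defs.reindex f (F I x))) ->
  (forall I (y : fib Q I), fiso (F I (G I y)) y) ->
  indexed_equiv P Q.
Proof.
move=> FE FN FG.
have Gmono I (x y : fib Q I) : fle x y -> fle (G I x) (G I y).
  move=> xy; apply/FE; apply: fle_trans (proj1 (FG I x)) _.
  exact: fle_trans xy (proj2 (FG I y)).
have Gnat I J (f : J -> I) (y : fib Q I) :
    fiso (G J (Defs.reindex f y)) (Defs.reindex f (G I y)).
  have [FGf1 FGf2] := FG J (Defs.reindex f y).
  have [FN1 FN2] := FN I J f (G I y).
  have [FG1 FG2] := FG I y.
  split; apply/FE.
    apply: fle_trans FGf1 _; apply: fle_trans FN2; exact: Defs.reindex_mono.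
  apply: fle_trans FN1 _; apply: fle_trans FGf2; exact: Defs.reindex_mono.
pose Fm := IndexedMap (fun I x y => proj2 (FE I x y)) FN.
pose Gm := IndexedMap Gmono Gnat.
exists Fm, Gm; split=> [I x|//].
by have [FG1 FG2] := FG I (F I x); split; apply/FE.
Qed.

(** * Combinators in the filter *)

Section Combinators.
Variable A : filtered_opca.

Lemma filter_const (c : A) : ffilter A c ->
  exists2 e, ffilter A e & lam1 e (fun=> Some c).
Proof.
move=> Fc; have [k Fk Hk] := ffilter_k A.
case e : (Some k @@ Some c) (kapp_isSome (kle_some (Hk c c))) => [kc|//] _.
exists kc => [|x]; first by apply: (ffilter_kapp _ _ e) => ? [<-].
by rewrite -e; apply: Hk.
Qed.

Lemma filter_subst (f g : A) : ffilter A f -> ffilter A g ->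
  exists2 e, ffilter A e & lam1 e (fun x => (Some f @@ x) @@ (Some g @@ x)).
Proof.
move=> Ff Fg; have [s Fs [Hs1 Hs2]] := ffilter_s A.
case e : (Some s @@ Some f @@ Some g) (Hs1 f g) => [h|//] _.
exists h => [|x]; last by rewrite -e; apply: Hs2.
apply: (ffilter_kapp _ _ e) => [b hb|b [<-] //].
by apply: (ffilter_kapp _ _ hb) => ? [<-].
Qed.

(** The element s (s (k a) f) g. *)
Lemma filter_subst2 (a f g : A) :
  ffilter A a -> ffilter A f -> ffilter A g ->
  exists2 e, ffilter A e &
    lam1 e (fun x => Some a @@ (Some f @@ x) @@ (Some g @@ x)).
Proof.
move=> Fa Ff Fg; have [ka Fka Hka] := filter_const Fa.
have [h Fh Hh] := filter_subst Fka Ff; have [e Fe He] := filter_subst Fh Fg.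
exists e => // x; apply: kle_trans (He x) _; apply: kle_appl.
apply: kle_trans (Hh x) _; exact: kle_appl.
Qed.

(** The element [e] represents <x> s (k x) c, so that [e x] is defined for
    every [x], whether or not [c y] and [x (c y)] are. *)
Lemma filter_precomp (c : A) : ffilter A c ->
  exists2 e, ffilter A e & lam2 e (fun x y => x @@ (Some c @@ y)).
Proof.
move=> Fc; have [k Fk Hk] := ffilter_k A; have [s Fs [Hs1 Hs2]] := ffilter_s A.
have [ks Fks Hks] := filter_const Fs; have [kc Fkc Hkc] := filter_const Fc.
have [h Fh Hh] := filter_subst Fks Fk; have [e Fe He] := filter_subst Fh Fkc.
have H x : Some e @@ Some x <~ Some s @@ (Some k @@ Some x) @@ Some c.
  apply: kle_trans (He x) _; apply: kle_app (Hkc x).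
  apply: kle_trans (Hh x) _; exact: kle_appl.
exists e => //; split=> [x|x y].
  move: (H x) (kapp_isSome (kle_some (Hk x x))).
  case: (Some k @@ Some x) => // kx + _.
  by case: (Some s @@ Some kx @@ Some c) (Hs1 kx c) => // d _ /kle_some.
apply: kle_trans (kle_appl (H x)) _.
move: (Hk x) (kapp_isSome (kle_some (Hk x x))).
case: (Some k @@ Some x) => // kx Hkx _.
by apply: kle_trans (Hs2 _ _ _) _; apply: kle_appl.
Qed.

End Combinators.

(** * Double negation into U *)

Section DoubleNegation.
Variables (A : filtered_opca) (U : downset A).
Variable I : Type.
Implicit Types phi psi : I -> down_fopca A.

Lemma neg_anti phi psi : fam_le phi psi -> fam_le (neg_U U psi) (neg_U U phi).
Proof.
move=> H; apply: neg_flip; apply: fam_le_trans H _.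
exact: dn_le_refl.
Qed.

Lemma neg_stable phi :
  fiso (P := fam (down_fopca A)) (neg_U U phi) (neg_U U (neg_U U (neg_U U phi))).
Proof. by split; [exact: dn_le_refl|apply: neg_anti; exact: dn_le_refl]. Qed.

Lemma dn_le_stable phi psi : fam_le (neg_U U (neg_U U psi)) psi ->
  dn_le U phi psi <-> fam_le phi psi.
Proof.
move=> H; split=> H1; first exact: fam_le_trans H1 H.
by apply: fam_le_trans H1 _; exact: dn_le_refl.
Qed.

End DoubleNegation.

(** * The order on Streicher's preorder, by realizers *)

Section RealizedOrder.
Variables (K : aks) (I : Type).
Implicit Types phi psi : I -> streicher_fopca K.

(** A quasi-proof can realize an inequality by application to terms, as here,
    or against pushed stacks, as in [push_fam_le].  The axiom [apole_app] makes
    the second form the stronger one, and [phi <= psi] gives the first. *)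
Lemma fam_le_app_reals phi psi : fam_le phi psi ->
  exists2 t, aqp t & forall i s, reals (bset (phi i)) s ->
    reals (bset (psi i)) (atapp t s).
Proof.
move=> [X [t [Xt Qt]] H]; exists t => // i s phis.
have [_ [<-] /bs_leP le] := H i _ erefl.
by apply: realsS le _ _; apply: reals_bullet.
Qed.

(** The orthogonal of the single term [t] serves as the element of the filter:
    it contains every stack [apush s p] of the hypothesis, so all its realizers
    behave on these stacks as [t] does. *)
Lemma push_fam_le phi psi t : aqp t ->
    (forall i s p, reals (bset (phi i)) s -> bset (psi i) p ->
      apole t (apush s p)) ->
  fam_le phi psi.
Proof.
move=> Qt H; exists (bs_orth [set t] : streicher_fopca K).
  by exists t; split=> // p; apply.
move=> i _ [<-]; eexists; first reflexivity.
apply/bs_leP => p psip; apply: sub_biorth => t' s Ht' phis.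
by apply: Ht' => _ ->; exact: H phis psip.
Qed.

End RealizedOrder.

(** * Realizers of stacks as downsets *)

Section Comparison.
Variables (A : filtered_opca) (C : seq_coding A) (T : krivine_terms C).
Variable U : downset A.
Let K := krivine_aks T U.

(** The partial application of [seq_b C] to a numeral is defined because it
    can be applied further, to the code of a long enough sequence. *)
Lemma filter_item n : exists2 b, ffilter A b & lam1 b (item C n).
Proof.
have [k _ _] := ffilter_k A.
have def : isSome (Some (seq_b C) @@ Some (num C n)).
  apply: (@kapp_isSome A _ (Some (code C (nseq n.+1 k)))).
  apply: (@kle_some A _ k).
  apply: kle_trans (seq_bE C _ _) _.
  by rewrite onth_nseq ltnSn; apply: kle_refl.
case e : (Some (seq_b C) @@ Some (num C n)) def => [b|//] _.
exists b => [|p]; last by rewrite -e; apply: kle_refl.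
by apply: (ffilter_kapp _ _ e) => ? [<-]; [exact: seq_b_filter|exact: num_filter].
Qed.

Lemma filter_tail n : exists2 c, ffilter A c & lam1 c (tail C n).
Proof.
have [k _ _] := ffilter_k A.
have h : (n <= size (k :: nseq n k))%N by rewrite /= size_nseq.
case e : (Some (seq_c C) @@ Some (num C n))
  (kapp_isSome (kle_some (seq_cE C h))) => [c|//] _.
exists c => [|p]; last by rewrite -e; apply: kle_refl.
by apply: (ffilter_kapp _ _ e) => ? [<-]; [exact: seq_c_filter|exact: num_filter].
Qed.

Fact stacks_down (X : set (astack K)) :
  down_closed [set x | exists2 p, X p & x <= sval p].
Proof. by move=> a b ab [p Xp bp]; exists p => //; exact: le_trans ab bp. Qed.

(** Closing downwards turns a set of stacks into an element of D(A, A') without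
    changing which elements send it into [U], since [U] is itself downwards
    closed. *)
Definition stack_downset (X : set (astack K)) : downset A :=
  Downset (@stacks_down X).

Lemma to_U_stack_downset (X : set (astack K)) :
  dset (to_U U (stack_downset X)) = reals X.
Proof.
apply/seteqP; split=> t Ht.
  by move=> p Xp; apply: Ht; exists p.
move=> b [p Xp bp]; apply: in_U_kle (Ht p Xp).
exact: app_mono.
Qed.

Definition realizers I (phi : I -> streicher_fopca K) : I -> down_fopca A :=
  neg_U U (fun i => stack_downset (bset (phi i))).

Lemma realizersE I (phi : I -> streicher_fopca K) i :
  dset (realizers phi i) = reals (bset (phi i)).
Proof. exact: to_U_stack_downset. Qed.

(** Application to a term [t] in the Krivine structure is application to [M t]
    in [A]; in the other direction, a stack is split into its head and its rest
    to simulate application in [A]. *)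
Lemma fam_le_realizers I (phi psi : I -> streicher_fopca K) :
  fam_le (realizers phi) (realizers psi) <-> fam_le phi psi.
Proof.
split=> [/down_fam_leP [a Fa Ha]|/fam_le_app_reals [t Ft Ht]]; last first.
  case e : (Some (kM T) @@ Some t)
    (kapp_isSome (proj1 (kME T) t t)) => [m|//] _.
  apply/down_fam_leP; exists m.
    by apply: (ffilter_kapp _ _ e) => ? [<-] //; apply: kM_filter.
  move=> i s; rewrite !realizersE => /Ht phits; exists (ktapp T t s) => //.
  by rewrite ktappE e.
(* The term t is <rho> a rho_0 rho_(>=1). *)
have [b Fb Hb] := filter_item 0; have [c Fc Hc] := filter_tail 1.
have [t Ft Ht] := filter_subst2 Fa Fb Fc.
apply: (@push_fam_le K I phi psi t) => // i s p phis psip.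
have [l el] := svalP p.
have le1 : sval (kpush s p) <= code C (s :: l) by apply: kpush_le; rewrite el.
have := Ha i s; rewrite !realizersE => /(_ phis) [d ead /(_ _ psip)].
apply: in_U_kle; apply: kle_trans (Ht _) _.
rewrite -[app d _]/(Some d @@ Some (sval p)) -ead.
apply: kle_app.
  apply: (@kle_appr _ _ (Some s)).
  by apply: kle_trans (Hb _) _; exact: item_le le1.
apply: kle_trans (Hc _) _.
by have := tail_le (n := 1) le1 isT; rewrite /= drop0 -el.
Qed.

(** An element [u] of alpha -> U need not be the code of a sequence, so it is
    represented by the stack (u).  The set of stacks defined here is the
    biorthogonal closure of the set of these one-element sequences. *)
Definition of_down_fam I (alpha : I -> down_fopca A) : I -> streicher_fopca K :=
  fun i => @bs_orth K [set t | forall u, dset (to_U U (alpha i)) u ->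
    in_U U (Some t @@ Some (code C [:: u]))].

Lemma realizers_of_down_famE I (alpha : I -> down_fopca A) i t :
  dset (realizers (of_down_fam alpha) i) t <->
  forall u, dset (to_U U (alpha i)) u ->
    in_U U (Some t @@ Some (code C [:: u])).
Proof.
rewrite realizersE; split=> [Ht u Hu|Ht p Hp]; last exact: Hp.
pose p : astack K := exist _ (code C [:: u]) (ex_intro _ [:: u] erefl).
by apply: (Ht p) => t'; apply.
Qed.

(** The realizers test on the codes of the (u) what the elements of the double
    negation test on the [u] themselves; precomposition with the coding [seq_t]
    and with the first projection translates between the two. *)
Lemma realizers_of_down_fam I (alpha : I -> down_fopca A) :
  fiso (P := fam (down_fopca A))
    (realizers (of_down_fam alpha)) (neg_U U (neg_U U alpha)).
Proof.
split; apply/down_fam_leP.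
  (* Here e t u is below t (seq_t u), hence below t applied to the code. *)
  have [e Fe [He1 He2]] := filter_precomp (seq_t_filter C).
  exists e => // i t /realizers_of_down_famE Ht.
  case et : (Some e @@ Some t) (He1 t) => [f|//] _.
  exists f => // u Hu; apply: in_U_kle (Ht u Hu).
  change (Some f @@ Some u <~ Some t @@ Some (code C [:: u])); rewrite -et.
  apply: kle_trans (He2 _ _) _; apply: kle_appr; exact: seq_tE.
have [b Fb Hb] := filter_item 0; have [e Fe [He1 He2]] := filter_precomp Fb.
exists e => // i t Ht.
case et : (Some e @@ Some t) (He1 t) => [f|//] _.
exists f => //; apply/realizers_of_down_famE => u Hu; apply: in_U_kle (Ht u Hu).
rewrite -et; apply: kle_trans (He2 _ _) _; apply: (kle_appr (y := Some u)).
by apply: kle_trans (Hb _) _; exact: seq_bE.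
Qed.

Lemma realizers_stable I (phi : I -> streicher_fopca K) :
  fiso (P := fam (down_fopca A))
    (realizers phi) (neg_U U (neg_U U (realizers phi))).
Proof. exact: neg_stable. Qed.

Lemma streicher_equiv_stable :
  indexed_equiv (fam (streicher_fopca K)) (booleanization_stable U).
Proof.
apply: (@indexed_equiv_of_embedding
  (fam (streicher_fopca K)) (booleanization_stable U)
  (fun I phi => exist _ (realizers phi) (realizers_stable phi) :
          fib (booleanization_stable U) I)
  (fun I alpha => of_down_fam (sval alpha))).
- by move=> I phi psi; apply: fam_le_realizers.
- by move=> I J f phi; split; apply: fam_le_refl.
move=> I [alpha [H1 H2]]; have [H3 H4] := realizers_of_down_fam alpha.
split; first exact: fam_le_trans H3 H2.
exact: fam_le_trans H1 H4.
Qed.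

Lemma dn_le_realizers I (phi psi : I -> streicher_fopca K) :
  dn_le U (realizers phi) (realizers psi) <-> fam_le phi psi.
Proof.
apply: iff_trans (fam_le_realizers phi psi).
by apply: dn_le_stable; have [] := realizers_stable psi.
Qed.

Lemma dn_iso_realizers_of_down_fam I (alpha : I -> down_fopca A) :
  fiso (P := booleanization_dn U) (realizers (of_down_fam alpha)) alpha.
Proof.
have [H1 H2] := realizers_of_down_fam alpha; split; first exact: H1.
apply: fam_le_trans (dn_le_refl U alpha) _.
exact: fam_le_trans H2 (dn_le_refl U _).
Qed.

Lemma streicher_equiv_dn :
  indexed_equiv (fam (streicher_fopca K)) (booleanization_dn U).
Proof.
apply: (@indexed_equiv_of_embedding
  (fam (streicher_fopca K)) (booleanization_dn U)
  (fun I phi => realizers phi : fib (booleanization_dn U) I)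
  (fun I alpha => of_down_fam alpha)).
- by move=> I phi psi; apply: dn_le_realizers.
- by move=> I J f phi; split; apply: dn_le_refl.
by move=> I alpha; apply: dn_iso_realizers_of_down_fam.
Qed.

Lemma streicher_equiv_contra :
  indexed_equiv (fam (streicher_fopca K)) (booleanization_contra U).
Proof.
apply: (@indexed_equiv_of_embedding
  (fam (streicher_fopca K)) (booleanization_contra U)
  (fun I phi => realizers phi : fib (booleanization_contra U) I)
  (fun I alpha => of_down_fam alpha)).
- move=> I phi psi; apply: iff_trans (dn_le_realizers phi psi).
  exact: iff_sym (dn_contra_le U _ _).
- by move=> I J f phi; split; apply: fam_le_refl.
move=> I alpha; have [H1 H2] := dn_iso_realizers_of_down_fam alpha.
by split; apply/dn_contra_le.
Qed.

End Comparison.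

Theorem theorem2p7 (A : filtered_opca) (C : seq_coding A)
    (T : krivine_terms C) (U : downset A)
    (hU : dset U `&` ffilter A = set0) :
  [/\ indexed_equiv (fam (streicher_fopca (krivine_aks T U)))
                    (booleanization_stable U),
      indexed_equiv (fam (streicher_fopca (krivine_aks T U)))
                    (booleanization_dn U)
    & indexed_equiv (fam (streicher_fopca (krivine_aks T U)))
                    (booleanization_contra U)].
Proof.
split; [exact: streicher_equiv_stable|exact: streicher_equiv_dn|].
exact: streicher_equiv_contra.
Qed.
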